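(* Let $n$ and $r$ be positive integers. Then: (a) $La(n,\bigvee,P_2)=La(n,\bigwedge,P_2)=\binom{n}{\lfloor n/2\rfloor}$. (b) $La(n,\{\bigvee,\bigwedge\},P_2)=\binom{n-1}{\lfloor (n-1)/2\rfloor}$. (c) $La(n,B,D_r)=\binom{\binom{n}{\lfloor n/2\rfloor}}{r}$. (d) $La(n,\bigvee,\bigwedge_r)=La(n,\bigwedge,\bigvee_r)=\binom{\binom{n}{\lfloor n/2\rfloor}}{r}$.
   Context: $[n]=\{1,\dots,n\}$, and $2^{[n]}$ is the family of all subsets of $[n]$. For a finite poset $P$ and a family $\mathcal{F}$ of sets, a subfamily $\mathcal{G}\subseteq\mathcal{F}$ is a copy of $P$ in $\mathcal{F}$ if there is a bijection $\phi:P\to\mathcal{G}$ such that $x\le_P x'$ implies $\phi(x)\subseteq\phi(x')$ (the converse implication is not required). $c(P,\mathcal{F})$ denotes the number of copies of $P$ in $\mathcal{F}$ (i.e. the number of such subfamilies $\mathcal{G}$). For posets $P,Q$, $La(n,P,Q)=\max\{c(Q,\mathcal{F}):\mathcal{F}\subseteq 2^{[n]},\ c(P,\mathcal{F})=0\}$. For families of posets $\mathcal{P},\mathcal{Q}$, $La(n,\mathcal{P},\mathcal{Q})=\max\{\sum_{Q\in\mathcal{Q}}c(Q,\mathcal{F}):\mathcal{F}\subseteq 2^{[n]},\ c(P,\mathcal{F})=0\text{ for all }P\in\mathcal{P}\}$; a single poset in either place stands for the one-element family containing it. Posets: $P_k$ is the chain on $k$ elements. $\bigvee_r$ has $r+1$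 elements $0,a_1,\dots,a_r$ with relations $0\le a_i$ for all $i$; $\bigwedge_r$ has $r+1$ elements $a_1,\dots,a_r,1$ with relations $a_i\le 1$ for all $i$; $\bigvee=\bigvee_2$ and $\bigwedge=\bigwedge_2$. The butterfly $B$ has four elements $a,b,c,d$ with $a,b\le c,d$ (all four relations). The generalized diamond $D_r$ has $r+2$ elements $a,b_1,\dots,b_r,c$ with $a<b_1,\dots,b_r<c$.
   Formalization: Part (c) is stated for all positive n, r except n = r = 1, where it fails: D_1 has three elements but 2^{[1]} has only two sets, so La(1,B,D_1) = 0 while the formula gives 1. *)

(* Defs.v *)
From HB Require Import structures.
From mathcomp Require Import all_boot all_order.

Set Implicit Arguments.
Unset Strict Implicit.
Unset Printing Implicit Defensive.

Import Order.TTheory.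

(* Bundling the display lets posets with different displays be put in one
   list. *)
Record finPoset := FinPoset {
  fp_disp : Order.disp_t;
  fp_sort :> finPOrderType fp_disp }.

(* Only the direction x <= y -> phi x \subset phi y is required: these are the
   weak (not necessarily induced) copies. *)
Definition is_copy (P : finPoset) (T : finType) (G : {set {set T}}) : bool :=
  [exists phi : {ffun P -> {set T}},
    [&& injectiveb phi, phi @: [set: P] == G
      & [forall x, forall y, (x <= y)%O ==> (phi x \subset phi y)]]].

(* Copies are counted as subfamilies G of F, not as embeddings phi. *)
Definition num_copies (P : finPoset) (T : finType) (F : {set {set T}}) : nat :=
  #|[set G : {set {set T}} | (G \subset F) && is_copy P G]|.

(* The ground set [n] is 'I_n; finite families of posets are lists. *)
Definition La_fam (n : nat) (Ps Qs : seq finPoset) : nat :=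
  \max_(F : {set {set 'I_n}} | all (fun P => num_copies P F == 0) Ps)
    \sum_(Q <- Qs) num_copies Q F.

Definition La (n : nat) (P Q : finPoset) : nat := La_fam n [:: P] [:: Q].

Definition chain (k : nat) : finPoset := FinPoset 'I_k.

Fact vee_display : Order.disp_t. Proof. exact: Order.Disp tt tt. Qed.
Fact wedge_display : Order.disp_t. Proof. exact: Order.Disp tt tt. Qed.
Fact butterfly_display : Order.disp_t. Proof. exact: Order.Disp tt tt. Qed.
Fact diamond_display : Order.disp_t. Proof. exact: Order.Disp tt tt. Qed.

(* None is the minimum 0, and Some i is a_(i+1). *)
Definition vee_type (r : nat) := option 'I_r.

Section Vee.
Variable r : nat.

HB.instance Definition _ := Finite.on (vee_type r).

Definition vee_le (x y : vee_type r) : bool := (x == y) || (x == None).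

Fact vee_le_refl : reflexive vee_le.
Proof. by move=> x; rewrite /vee_le eqxx. Qed.

Fact vee_le_anti : antisymmetric vee_le.
Proof.
move=> x y /andP[/orP[/eqP //|/eqP ->]].
by case/orP=> /eqP.
Qed.

Fact vee_le_trans : transitive vee_le.
Proof.
move=> y x z /orP[/eqP -> //|/eqP -> _].
by rewrite /vee_le eqxx orbT.
Qed.

HB.instance Definition _ := Order.Le_isPOrder.Build vee_display (vee_type r)
  vee_le_refl vee_le_anti vee_le_trans.

End Vee.

Definition vee (r : nat) : finPoset := FinPoset (vee_type r).

(* None is the maximum 1, and Some i is a_(i+1). *)
Definition wedge_type (r : nat) := option 'I_r.

Section Wedge.
Variable r : nat.

HB.instance Definition _ := Finite.on (wedge_type r).

Definition wedge_le (x y : wedge_type r) : bool := (x == y) || (y == None).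

Fact wedge_le_refl : reflexive wedge_le.
Proof. by move=> x; rewrite /wedge_le eqxx. Qed.

Fact wedge_le_anti : antisymmetric wedge_le.
Proof.
move=> x y /andP[/orP[/eqP //|/eqP ->]].
by case/orP=> /eqP.
Qed.

Fact wedge_le_trans : transitive wedge_le.
Proof.
move=> y x z + /orP[/eqP <- //|/eqP ->].
by rewrite /wedge_le eqxx orbT.
Qed.

HB.instance Definition _ := Order.Le_isPOrder.Build wedge_display (wedge_type r)
  wedge_le_refl wedge_le_anti wedge_le_trans.

End Wedge.

Definition wedge (r : nat) : finPoset := FinPoset (wedge_type r).

(* The first component is the level: a, b are (false, _) and c, d are
   (true, _). *)
Definition butterfly_type := (bool * bool)%type.

HB.instance Definition _ := Finite.on butterfly_type.

Definition butterfly_le (x y : butterfly_type) : bool :=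
  (x == y) || (~~ x.1 && y.1).

Fact butterfly_le_refl : reflexive butterfly_le.
Proof. by move=> x; rewrite /butterfly_le eqxx. Qed.

Fact butterfly_le_anti : antisymmetric butterfly_le.
Proof. by move=> [[] []] [[] []]. Qed.

Fact butterfly_le_trans : transitive butterfly_le.
Proof. by move=> [[] []] [[] []] [[] []]. Qed.

HB.instance Definition _ :=
  Order.Le_isPOrder.Build butterfly_display butterfly_type
    butterfly_le_refl butterfly_le_anti butterfly_le_trans.

Definition butterfly : finPoset := FinPoset butterfly_type.

(* inl false is the minimum a, inl true is the maximum c, and inr i is
   b_(i+1). *)
Definition diamond_type (r : nat) := (bool + 'I_r)%type.

Section Diamond.
Variable r : nat.

HB.instance Definition _ := Finite.on (diamond_type r).

Definition diamond_le (x y : diamond_type r) : bool :=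
  [|| x == y, x == inl false | y == inl true].

Fact diamond_le_refl : reflexive diamond_le.
Proof. by move=> x; rewrite /diamond_le eqxx. Qed.

Fact diamond_le_anti : antisymmetric diamond_le.
Proof.
move=> x y /andP[/or3P[/eqP //|/eqP ->|/eqP ->]];
  by case/or3P=> /eqP.
Qed.

Fact diamond_le_trans : transitive diamond_le.
Proof.
move=> y x z /or3P[/eqP -> //|/eqP -> _|/eqP ->].
  by rewrite /diamond_le eqxx orbT.
by case/or3P=> /eqP E //; rewrite /diamond_le -?E ?E eqxx !orbT.
Qed.

HB.instance Definition _ :=
  Order.Le_isPOrder.Build diamond_display (diamond_type r)
    diamond_le_refl diamond_le_anti diamond_le_trans.

End Diamond.

Definition diamond (r : nat) : finPoset := FinPoset (diamond_type r).

(* Main.v *)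
(* A family without a V has an antichain of non-maximal members, and each of
   these has a unique proper superset in the family; a family without a
   butterfly has an antichain of members that are neither minimal nor maximal,
   and each of these has a unique proper subset and a unique proper superset in
   the family. Hence a copy of the wedge, or of the diamond, is determined by an
   r-subset of an antichain, and Sperner's theorem bounds the number of copies.
   A middle layer together with the full set (and the empty set for the
   diamond) attains the bound; complementation exchanges V and wedge.

   In a family without V and wedge the comparable pairs A < B are mutually
   incomparable, and B may be replaced by a one-element extension of A; a count
   of the maximal chains meeting these pairs, as in the LYM inequality, bounds
   their number. The sets X such that X minus a fixed point has size
   (n-1)/2 attain this bound. *)
Require Import Defs.
From mathcomp Require Import all_boot all_order.
From mathcomp Require Import zify.

Set Implicit Arguments.
Unset Strict Implicit.
Unset Printing Implicit Defensive.

(** * Chain counting and Sperner's theorem *)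

Lemma leq_bin_half n k : 'C(n, k) <= 'C(n, n %/ 2).
Proof.
have step m : m < n %/ 2 -> 'C(n, m) <= 'C(n, m.+1).
  move=> lt_m; rewrite -(leq_pmul2l (ltn0Sn m)) mul_bin_left leq_mul2r.
  by apply/orP; right; lia.
have low d : d <= n %/ 2 -> 'C(n, n %/ 2 - d) <= 'C(n, n %/ 2).
  elim: d => [|d IH] le_d; first by rewrite subn0.
  apply: leq_trans (IH (ltnW le_d)).
  by rewrite -(subnSK le_d); apply: step; lia.
case: (leqP k (n %/ 2)) => [le_k|lt_k].
  by rewrite -(subKn le_k) low ?leq_subr.
case: (leqP k n) => [le_kn|lt_nk]; last by rewrite bin_small.
rewrite -(bin_sub le_kn).
have -> : n - k = n %/ 2 - (n %/ 2 - (n - k)) by lia.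
by apply: low; lia.
Qed.

Section SetFamilies.
Variable T : finType.
Implicit Types (A B D X : {set T}) (E F G S : {set {set T}}).

(* [#|D|`!] counts the maximal chains of the subsets of [D]: [W D] should be
   read as the number of those that meet a given family. *)
Lemma chain_weight_bound (W : {set T} -> nat) :
    (forall D, W D <= #|D|`! \/ W D <= \sum_(x in D) W (D :\ x)) ->
  forall D, W D <= #|D|`!.
Proof.
move=> W_step D; have [m] := ubnP #|D|; elim: m D => // m IH D lt_D.
case: (W_step D) => // /leq_trans; apply.
apply: (@leq_trans (\sum_(x in D) (#|D|.-1)`!)).
  apply: leq_sum => x Dx; have := cardsD1 x D; rewrite Dx => cD.
  by rewrite cD add1n; apply: IH; lia.
by rewrite sum_nat_const; case: #|D| => // d; rewrite factS.
Qed.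

(* The weights count the maximal chains through [A] or [g A |: A]; choosing
   [g A |: A] one level above [A] makes the count [n] times the number of
   maximal chains through [A] in a ground set of size [n.-1]. *)
Lemma separated_covers_bound E (g : {set T} -> T) :
    {in E, forall A, g A \notin A} ->
    {in E &, forall A B, A \subset g B |: B -> A = B} ->
  #|E| <= 'C(#|T|.-1, #|T|.-1 %/ 2).
Proof.
move=> g_out sepE.
(* With [a = #|A|] and [d = #|D|], inclusion-exclusion over the chains through [A], through
   [g A |: A] and through both gives [a! (d-a)! + (a+1)! (d-a-1)! - a! (d-a-1)! = d a! (d-1-a)!]. *)
pose w A D := if g A |: A \subset D then #|D| * (#|A|`! * (#|D|.-1 - #|A|)`!)
              else if A \subset D then #|A|`! * (#|D| - #|A|)`! else 0.
have w0 A D : ~~ (A \subset D) -> w A D = 0.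
  by rewrite /w subUset => /negbTE->; rewrite andbF.
(* Maximal chains of [D] are sorted by the point [x] missing from their second largest member. As
   [D] is neither set of the pair, a chain meets the pair exactly when its part inside [D :\ x]
   does. *)
have wstep A D : A \in E -> D != A -> D != g A |: A ->
    w A D <= \sum_(x in D) w A (D :\ x).
  move=> EA neDA neDgA; rewrite [w A D]/w.
  have cgA : #|g A |: A| = #|A|.+1 by rewrite cardsU1 (g_out _ EA).
  case: ifPn => [sBD|nsBD].
    have [Dg sAD] : g A \in D /\ A \subset D.
      by move: sBD; rewrite subUset sub1set => /andP[].
    have ltBD : #|A|.+1 < #|D|.
      by rewrite -cgA proper_card // properEneq eq_sym neDgA.
    (* Removing [g A] leaves a set containing [A] but not [g A |: A]; each point outside [g A |: A]
       contributes the constant [c] below. *)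
    rewrite (bigD1 (g A)) //=.
    have -> : w A (D :\ g A) = #|A|`! * (#|D|.-1 - #|A|)`!.
      rewrite /w subUset sub1set in_setD1 eqxx /= subsetD1 sAD (g_out _ EA) /=.
      by have := cardsD1 (g A) D; rewrite Dg add1n => ->.
    pose c := #|D|.-1 * (#|A|`! * (#|D|.-2 - #|A|)`!).
    have le_c : #|D :\: (g A |: A)| * c <=
        \sum_(x in D | x != g A) w A (D :\ x).
      rewrite -sum_nat_const [leqRHS](bigID [pred x | x \notin A]) /=.
      rewrite -[leqLHS]addn0 leq_add //.
      rewrite (eq_bigl (fun x => (x \in D) && (x != g A) && (x \notin A))).
        apply: leq_sum => x /andP[/andP[Dx nxg] nxA].
        rewrite /w subsetD1 sBD /= in_setU1 (negbTE nxg) (negbTE nxA) /= /c.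
        by have := cardsD1 x D; rewrite Dx add1n => ->.
      by move=> x; rewrite !inE negb_or andbC andbA.
    rewrite cardsD (setIidPr sBD) cgA in le_c.
    apply: leq_trans (leq_add (leqnn _) le_c); rewrite /c.
    (* This form of [#|D|] makes all truncated subtractions exact. *)
    have [d ->] : exists d, #|D| = d + #|A|.+2.
      by exists (#|D| - #|A|.+2); rewrite subnK.
    have -> : (d + #|A|.+2).-1 - #|A| = d.+1 by lia.
    have -> : d + #|A|.+2 - #|A|.+1 = d.+1 by lia.
    have -> : (d + #|A|.+2).-2 - #|A| = d by lia.
    by rewrite factS; nia.
  case: ifPn => // sAD.
  have ltAD : #|A| < #|D|.
    by rewrite proper_card // properEneq eq_sym neDA.
  have nDg : g A \notin D.
    by move: nsBD; rewrite subUset sub1set sAD andbT.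
  apply: (@leq_trans (\sum_(x in D :\: A) #|A|`! * (#|D|.-1 - #|A|)`!)).
    rewrite sum_nat_const cardsD (setIidPr sAD).
    have -> : #|D|.-1 - #|A| = (#|D| - #|A|).-1 by lia.
    by case: (#|D| - #|A|) (subn_gt0 #|A| #|D|) => [|d _]; rewrite ?ltAD // mulnCA.
  rewrite [leqRHS](bigID [pred x | x \notin A]) /= -[leqLHS]addn0 leq_add //.
  rewrite (eq_bigl (fun x => (x \in D) && (x \notin A))); last first.
    by move=> x; rewrite inE andbC.
  apply: leq_sum => x /andP[Dx nxA].
  rewrite /w subUset sub1set in_setD1 (negbTE nDg) andbF /= subsetD1 sAD nxA /=.
  by have := cardsD1 x D; rewrite Dx add1n => ->.
have bound : \sum_(A in E) w A setT <= #|T|`!.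
  rewrite -cardsT; move: {1 2}setT; apply: chain_weight_bound => D.
  (* If [D] belongs to the pair of some [A], separation leaves no other member of [E] inside [D], so
     the total is the single weight of [A], the factorial of [#|D|]. Otherwise [wstep] applies to
     every summand. *)
  have [/exists_inP[A EA DA]|/exists_inPn noA] :=
      boolP [exists A in E, (D == A) || (D == g A |: A)]; last first.
    right; rewrite exchange_big; apply: leq_sum => A EA.
    by have := noA A EA; rewrite negb_or => /andP[]; apply: wstep.
  left; rewrite (bigD1 A) //= big1 ?addn0 => [|B /andP[EB neBA]]; last first.
    apply/w0/negP=> sBD; case/negP: neBA; apply/eqP/sepE => //.
    by apply: subset_trans sBD _; case/orP: DA => /eqP->; rewrite ?subsetUr.
  case/orP: DA => /eqP->; rewrite /w.
    by rewrite subUset sub1set (negbTE (g_out _ EA)) subxx subnn muln1.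
  by rewrite subxx cardsU1 (g_out _ EA) /= subnn muln1 add1n factS.
have [-> | [A0 EA0]] := set_0Vmem E; first by rewrite cards0.
have T_gt0 : 0 < #|T| by apply/card_gt0P; exists (g A0).
have card_lt A : A \in E -> #|A| <= #|T|.-1.
  move=> /g_out gA; rewrite -ltnS prednK // -[#|T|]cardsT; apply: proper_card.
  by apply/properP; split; [exact: subsetT | exists (g A)].
rewrite -(leq_pmul2r (fact_gt0 #|T|)).
apply: leq_trans (leq_mul (leqnn _) bound).
rewrite -sum_nat_const big_distrr; apply: leq_sum => A EA.
(* With [n = #|T|] and [a = #|A|], [n!] is [C(n-1, a)] times the weight [n a! (n-1-a)!], and the
   central coefficient dominates [C(n-1, a)]. *)
rewrite /w subsetT cardsT -{1}(prednK T_gt0) factS prednK //=.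
rewrite -(bin_fact (card_lt A EA)) mulnCA.
by rewrite leq_mul2r leq_bin_half orbT.
Qed.
End SetFamilies.

(* Adjoining to the ground set a new point, which plays the role of [g A] for
   all [A], turns an antichain into a family of separated covers. *)
Lemma sperner (T : finType) (E : {set {set T}}) :
    {in E &, forall A B : {set T}, A \subset B -> A = B} ->
  #|E| <= 'C(#|T|, #|T| %/ 2).
Proof.
move=> antiE; pose up (A : {set T}) := Some @: A.
have up_inj : injective up by apply/imset_inj/Some_inj.
have NoneP A : None \notin up A by apply/imsetP=> -[].
rewrite -(card_imset _ up_inj); have := @separated_covers_bound _ (up @: E) (fun=> None).
rewrite card_option /=; apply => [_ /imsetP[A _ ->]|]; first exact: NoneP.
move=> _ _ /imsetP[A EA ->] /imsetP[B EB ->] sAB; congr up; apply: antiE => //.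
apply/subsetP=> x Ax; have := subsetP sAB (Some x) (imset_f _ Ax).
by rewrite in_setU1 /= (mem_imset _ _ Some_inj).
Qed.

(** * Copies of posets, isomorphism and complementation *)

Lemma enum_imset (U : finType) (A : {set U}) r :
  #|A| = r -> exists2 f : 'I_r -> U, injective f & f @: setT = A.
Proof.
move=> <-; exists enum_val; first exact: enum_val_inj.
apply/setP=> x; apply/imsetP/idP => [[i _ ->]|Ax]; first exact: enum_valP.
by exists (enum_rank_in Ax x); rewrite ?enum_rankK_in.
Qed.

Lemma is_copyP (P : finPoset) (T : finType) (G : {set {set T}}) :
  reflect (exists phi : P -> {set T}, [/\ injective phi, phi @: setT = G
             & forall x y, (x <= y)%O -> phi x \subset phi y])
          (is_copy P G).
Proof.
apply: (iffP existsP) => [[phi]|[phi [phi_inj phiG phi_le]]].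
  case/and3P=> /injectiveP phi_inj /eqP phiG /forallP phi_le.
  exists phi; split=> // x y; have /forallP/(_ y)/implyP := phi_le x; exact.
exists (finfun phi); apply/and3P; split.
- by apply/injectiveP=> x y; rewrite !ffunE => /phi_inj.
- by apply/eqP; rewrite -phiG; apply: eq_imset => x; rewrite ffunE.
- by apply/forallP=> x; apply/forallP=> y; apply/implyP; rewrite !ffunE;
    apply: phi_le.
Qed.

Lemma num_copies0 (P : finPoset) (T : finType) (F : {set {set T}}) :
  num_copies P F = 0 <-> forall G : {set {set T}}, G \subset F -> ~~ is_copy P G.
Proof.
rewrite /num_copies; split=> [/eqP|H].
  rewrite cards_eq0 => /eqP/setP H G sGF; apply/negP=> cG.
  by have := H G; rewrite !inE sGF cG.
apply/eqP; rewrite cards_eq0; apply/eqP/setP=> G; rewrite !inE.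
by apply/andP=> -[/H/negP].
Qed.

(** Precomposing an embedding with [f] keeps its image; as copies are weak, monotonicity of [f]
    suffices. *)
Lemma is_copy_bij_homo (P Q : finPoset) (f : P -> Q) (T : finType)
    (G : {set {set T}}) :
    bijective f -> (forall x y, (x <= y)%O -> (f x <= f y)%O) ->
  is_copy Q G -> is_copy P G.
Proof.
move=> [g fK gK] f_le /is_copyP[phi [phi_inj <- phi_le]].
apply/is_copyP; exists (phi \o f); split=> [|| x y /f_le/phi_le //].
  by apply: inj_comp => //; apply: can_inj fK.
apply/setP=> A; apply/imsetP/imsetP => -[x _ ->]; first by exists (f x).
by exists (g x) => //=; rewrite gK.
Qed.

Definition dual_posets (P Q : finPoset) :=
  exists2 f : P -> Q, bijective f & forall x y, (x <= y)%O = (f y <= f x)%O.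

Lemma dual_posets_sym P Q : dual_posets P Q -> dual_posets Q P.
Proof.
move=> [f [g fK gK] f_le]; exists g; first by exists f.
by move=> x y; rewrite f_le !gK.
Qed.

Section Complements.
Variable T : finType.
Implicit Types F G : {set {set T}}.

Definition compls F := [set ~: A | A in F].

Lemma complsK : involutive compls.
Proof.
move=> F; rewrite /compls -imset_comp -[RHS]imset_id.
by apply: eq_imset => A /=; rewrite setCK.
Qed.

(** Complementation reverses inclusion, so composing it with an order-reversing bijection gives a
    monotone embedding again; the converse follows by involutivity. *)
Lemma is_copy_compls P Q G : dual_posets P Q -> is_copy P (compls G) = is_copy Q G.
Proof.
have imp P' Q' G' : dual_posets P' Q' -> is_copy Q' G' -> is_copy P' (compls G').
  move=> [f [g fK gK] f_le] /is_copyP[phi [phi_inj <- phi_le]].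
  apply/is_copyP; exists (fun x => ~: phi (f x)); split=> [x y /setC_inj/phi_inj||].
  - exact: can_inj fK x y.
  - apply/setP=> A; apply/imsetP/imsetP => [[x _ ->]|[_ /imsetP[y _ ->] ->]].
      by exists (phi (f x)); rewrite ?imset_f.
    by exists (g y); rewrite ?gK.
  - by move=> x y; rewrite f_le setCS; apply: phi_le.
move=> dPQ; apply/idP/idP; last exact: imp.
by rewrite -[in X in _ -> X](complsK G); apply/imp/dual_posets_sym.
Qed.

Lemma num_copies_compls P Q F :
  dual_posets P Q -> num_copies P (compls F) = num_copies Q F.
Proof.
move=> dPQ; rewrite /num_copies -(card_imset _ (can_inj complsK)).
congr #|pred_of_set _|; apply/setP=> G; rewrite inE.
apply/imsetP/andP => [[G']|[sGF cG]].
  rewrite inE => /andP[sG' cG'] ->; split.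
    by rewrite -(complsK F) imsetS.
  by rewrite -(is_copy_compls _ dPQ) complsK.
exists (compls G); rewrite ?complsK // inE imsetS //=.
by rewrite (is_copy_compls _ dPQ).
Qed.
End Complements.

(** Complementation permutes the families over which the maximum is taken. *)
Lemma La_dual n P P' Q Q' :
  dual_posets P P' -> dual_posets Q Q' -> La n P Q = La n P' Q'.
Proof.
move=> dP dQ; rewrite /La /La_fam (reindex_inj (can_inj (@complsK _))) /=.
apply: eq_big => F; first by rewrite (num_copies_compls _ dP).
by rewrite !big_seq1 (num_copies_compls _ dQ).
Qed.

Lemma wedge_vee_dual r : dual_posets (wedge r) (vee r).
Proof.
exists id => [|x y]; first by exists id.
by rewrite [LHS]/(wedge_le x y) [RHS]/(vee_le y x) /wedge_le /vee_le eq_sym.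
Qed.

(** Makes the count of comparable pairs the case [r = 1] of the wedge count. *)
Lemma is_copy_chain2 (T : finType) (G : {set {set T}}) :
  is_copy (chain 2) G = is_copy (wedge 1) G.
Proof.
apply/idP/idP.
  pose f (x : wedge 1) : chain 2 := if x is Some _ then ord0 else ord_max.
  apply: (@is_copy_bij_homo _ _ f).
    apply: inj_card_bij; last by rewrite card_option !card_ord.
    by move=> [i|] [j|] //= _; rewrite !ord1.
  by move=> x y /orP[/eqP->|/eqP->] //; apply: leq_ord.
pose f (x : chain 2) : wedge 1 := if x == ord0 then Some ord0 else None.
apply: (@is_copy_bij_homo _ _ f).
  apply: inj_card_bij; last by rewrite card_option !card_ord.
  by move=> [[|[|//]] ?] [[|[|//]] ?] //= _; apply: val_inj.
by move=> [[|[|//]] ?] [[|[|//]] ?].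
Qed.

Lemma num_copies_chain2 (T : finType) (F : {set {set T}}) :
  num_copies (chain 2) F = num_copies (wedge 1) F.
Proof. by apply: eq_card => G; rewrite !inE is_copy_chain2. Qed.

Lemma La_fam_chain2 n Ps : La_fam n Ps [:: chain 2] = La_fam n Ps [:: wedge 1].
Proof. by apply: eq_bigr => F _; rewrite !big_seq1 num_copies_chain2. Qed.

Lemma La_fam_eq n Ps Q m (F0 : {set {set 'I_n}}) :
    all (fun P => num_copies P F0 == 0) Ps -> m <= num_copies Q F0 ->
    (forall F : {set {set 'I_n}},
       all (fun P => num_copies P F == 0) Ps -> num_copies Q F <= m) ->
  La_fam n Ps [:: Q] = m.
Proof.
move=> free0 ge_m le_m; apply/eqP; rewrite eqn_leq; apply/andP; split.
  by apply/bigmax_leqP=> F; rewrite big_seq1; apply: le_m.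
by apply: leq_trans (leq_bigmax_cond _ free0); rewrite big_seq1.
Qed.

(** * Forbidden configurations and the sets that determine a copy *)

Section Copies.
Variable T : finType.
Implicit Types (A B C D X : {set T}) (F G S N : {set {set T}}).

(** Injectivity makes the inclusions in the top [t] proper; the members of [S] may be comparable to
    each other, since copies are weak. *)
Lemma wedge_copyP r G :
  reflect (exists (t : {set T}) S, [/\ #|S| = r, {in S, forall A, A \proper t} & G = t |: S])
          (is_copy (wedge r) G).
Proof.
apply: (iffP (is_copyP _ _)) => [[phi [phi_inj <- phi_le]]|[t [S [cS ltS ->]]]].
  exists (phi None), [set phi (Some i) | i : 'I_r]; split.
  - by rewrite card_imset ?card_ord // => i j /phi_inj[].
  - move=> _ /imsetP[i _ ->]; rewrite properEneq phi_le ?andbT.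
      by apply/eqP=> /phi_inj.
    exact: orbT.
  - apply/setP=> A; rewrite in_setU1; apply/imsetP/predU1P.
      move=> [[i|] _ ->]; last by left.
      by right; apply: imset_f.
    by move=> [->|/imsetP[i _ ->]]; [exists None | exists (Some i)].
have [f f_inj fS] := enum_imset cS.
have f_lt i : f i \proper t by apply: ltS; rewrite -fS imset_f.
exists (fun x : option 'I_r => if x is Some i then f i else t); split.
- move=> [i|] [j|] //; first by move=> /f_inj->.
    by move=> E; have := f_lt i; rewrite E properxx.
  by move=> E; have := f_lt j; rewrite E properxx.
- apply/setP=> A; rewrite in_setU1 -fS; apply/imsetP/predU1P.
    move=> [[i|] _ ->]; last by left.
    by right; apply: imset_f.
  by move=> [->|/imsetP[i _ ->]]; [exists None | exists (Some i)].
- by move=> x y /orP[/eqP->|/eqP->] //; case: x => // i; apply: proper_sub.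
Qed.

Lemma wedge2_free F :
  num_copies (wedge 2) F = 0 <->
  {in F & &, forall A B C : {set T}, A \proper C -> B \proper C -> A = B}.
Proof.
rewrite num_copies0; split=> [free A B C FA FB FC ltAC ltBC|free G sGF].
  apply/eqP/negPn/negP=> neAB.
  have sGF : [set C; A; B] \subset F by rewrite !subUset !sub1set FA FB FC.
  case/negP: (free _ sGF); apply/wedge_copyP; exists C, [set A; B]; split.
  - by rewrite cards2 neAB.
  - by move=> X /set2P[]->.
  - by rewrite setUA.
apply/negP=> /wedge_copyP[C [S [/eqP/cards2P[A [B [neAB ->]]] ltS defG]]].
case/eqP: neAB; move: sGF; rewrite defG !subUset !sub1set.
by case/and3P=> FC FA FB; apply: (free A B C) => //; apply: ltS; rewrite !inE eqxx ?orbT.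
Qed.

Lemma vee2_free F :
  num_copies (vee 2) F = 0 <->
  {in F & &, forall A B C : {set T}, A \proper B -> A \proper C -> B = C}.
Proof.
rewrite -(num_copies_compls _ (wedge_vee_dual 2)) wedge2_free.
split=> free A B C FA FB FC ltAB ltAC.
  by apply/setC_inj/(free _ _ (~: A)); rewrite ?imset_f ?properC.
move: FA FB FC ltAB ltAC => /imsetP[A' FA ->] /imsetP[B' FB ->] /imsetP[C' FC ->].
by rewrite !properC => ltA ltB; congr (~: _); apply: (free C').
Qed.

Lemma butterfly_free F :
  num_copies butterfly F = 0 <->
  (forall A B C D : {set T}, A \in F -> B \in F -> C \in F -> D \in F ->
    A \proper C -> B \proper C -> A \proper D -> B \proper D ->
    A = B \/ C = D).
Proof.
rewrite num_copies0; split=> [free A B C D FA FB FC FD ltAC ltBC ltAD ltBD|free G sGF].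
  have [-> | neAB] := eqVneq A B; first by left.
  have [-> | neCD] := eqVneq C D; first by right.
  have sGF : [set A; B; C; D] \subset F.
    by rewrite !subUset !sub1set FA FB FC FD.
  case/negP: (free _ sGF); apply/is_copyP.
  exists (fun x : bool * bool =>
    if x.1 then if x.2 then D else C else if x.2 then B else A); split.
  (* The four proper inclusions and the two assumed inequalities separate all six pairs. *)
  - move: neAB neCD ltAC ltBC ltAD ltBD; move=> /eqP neAB /eqP neCD.
    rewrite !properEneq => /andP[/eqP ? _] /andP[/eqP ? _] /andP[/eqP ? _].
    move=> /andP[/eqP ? _].
    by move=> [[] []] [[] []] //= E; congruence.
  - apply/setP=> X; rewrite !inE -!orbA; apply/imsetP/or4P.
      by move=> [[[] []] _ -> /=]; rewrite eqxx; constructor.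
    case=> /eqP->; [exists (false, false)|exists (false, true)
      |exists (true, false)|exists (true, true)] => //.
  - move=> x y /orP[/eqP->//|].
    by case: x y => [[] []] [[] []] //= _; apply: proper_sub.
apply/negP=> /is_copyP[phi [phi_inj defG phi_le]].
have Fphi x : phi x \in F by rewrite (subsetP sGF) // -defG imset_f.
have lt b b' : phi (false, b) \proper phi (true, b').
  by rewrite properEneq phi_le // andbT; apply/eqP=> /phi_inj.
by case: (free _ _ _ _ (Fphi (false, false)) (Fphi (false, true))
  (Fphi (true, false)) (Fphi (true, true))) => // /phi_inj.
Qed.

(** The condition [a \proper c] is stated separately because [S] is empty when [r = 0]. *)
Lemma diamond_copyP r G :
  reflect (exists (a c : {set T}) S,
             [/\ #|S| = r, a \proper c,
                 {in S, forall A, (a \proper A) && (A \proper c)}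
               & G = [set a; c] :|: S])
          (is_copy (diamond r) G).
Proof.
have le_diamond (x y : diamond r) : (x <= y)%O = diamond_le x y by [].
apply: (iffP (is_copyP _ _)) => [[phi [phi_inj <- phi_le]]|[a [c [S [cS ltac ltS ->]]]]].
  have phi_lt x y : diamond_le x y -> x != y -> phi x \proper phi y.
    move=> le_xy ne_xy; rewrite properEneq phi_le ?andbT //.
    by apply/eqP=> /phi_inj/eqP; apply/negP.
  exists (phi (inl false)), (phi (inl true)), [set phi (inr i) | i : 'I_r]; split.
  - by rewrite card_imset ?card_ord // => i j /phi_inj[].
  - exact: phi_lt.
  - move=> _ /imsetP[i _ ->].
    by rewrite !phi_lt.
  - apply/setP=> A; rewrite !inE -orbA; apply/imsetP/or3P.
      move=> [[[]|i] _ ->]; rewrite ?eqxx; try by constructor.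
      by constructor 3; apply: imset_f.
    case=> [/eqP->|/eqP->|/imsetP[i _ ->]];
      [exists (inl false)|exists (inl true)|exists (inr i)] => //.
have [f f_inj fS] := enum_imset cS.
have f_lt i : (a \proper f i) /\ (f i \proper c).
  by apply/andP/ltS; rewrite -fS imset_f.
exists (fun x : bool + 'I_r =>
  match x with inl true => c | inl false => a | inr i => f i end); split.
- have ne A B : A \proper B -> A <> B by move=> + E; rewrite E properxx.
  have [neac nefc neaf] : [/\ a <> c, forall i, f i <> c & forall i, a <> f i].
    by split=> [|i|i]; apply: ne => //; case: (f_lt i).
  by move=> [[]|i] [[]|j] // E; [case: neac | case: (nefc j) | case: (neaf j)
    | case: (nefc i) | case: (neaf i) | rewrite (f_inj _ _ E)].
- apply/setP=> A; rewrite !inE -orbA -fS; apply/imsetP/or3P.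
    move=> [[[]|i] _ ->]; rewrite ?eqxx; try by constructor.
    by constructor 3; apply: imset_f.
  case=> [/eqP->|/eqP->|/imsetP[i _ ->]];
    [exists (inl false)|exists (inl true)|exists (inr i)] => //.
- move=> x y; rewrite le_diamond => /or3P[/eqP->|/eqP->|/eqP->] //.
    by case: y => [[]|i] //; apply: proper_sub => //; case: (f_lt i).
  by case: x => [[]|i] //; apply: proper_sub => //; case: (f_lt i).
Qed.

(** Every copy is the image under [h] of some [r]-subset of [N]. *)
Lemma num_copies_le Q F N (r : nat) (h : {set {set T}} -> {set {set T}}) :
    (forall G, G \subset F -> is_copy Q G ->
       exists2 S : {set {set T}}, (S \subset N) && (#|S| == r) & G = h S) ->
  num_copies Q F <= 'C(#|N|, r).
Proof.
move=> hP; rewrite -cards_draws.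
apply: leq_trans (leq_imset_card h _); apply: subset_leq_card.
apply/subsetP=> G; rewrite inE => /andP[sGF cG].
by have [S drawS ->] := hP G sGF cG; rewrite imset_f ?inE.
Qed.

(** Intersecting with [N] recovers [S], so [h] is injective on the [r]-subsets of [N]. *)
Lemma num_copies_ge Q F N (r : nat) (h : {set {set T}} -> {set {set T}}) :
    (forall S : {set {set T}}, S \subset N -> #|S| = r ->
       [/\ h S \subset F, is_copy Q (h S) & h S :&: N = S]) ->
  'C(#|N|, r) <= num_copies Q F.
Proof.
move=> hP; rewrite -cards_draws -(@card_in_imset _ _ h).
  apply/subset_leq_card/subsetP=> _ /imsetP[S + ->].
  by rewrite !inE => /andP[sSN /eqP cS]; have [-> -> _] := hP S sSN cS.
move=> S S'; rewrite !inE => /andP[sSN /eqP cS] /andP[sSN' /eqP cS'] E.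
by have [_ _ <-] := hP S sSN cS; rewrite E; have [_ _ ->] := hP S' sSN' cS'.
Qed.

(* In the two cases where it is used, a copy is [comparables F S] for the set
   [S] of its members lying in the antichain. *)
Definition comparables F S :=
  [set X in F | [exists A in S, (X \subset A) || (A \subset X)]].

Definition nonmaximal F := [set A in F | [exists B in F, A \proper B]].

(** A member [A] of [S] has [t] as its only proper superset in [F], and no [X] in [F] lies properly
    below [A], as [X] would have the two proper supersets [A] and [t]. So [S] determines the
    copy. *)
Lemma wedge_copies_le r F :
    0 < r -> num_copies (vee 2) F = 0 ->
  num_copies (wedge r) F <= 'C(#|nonmaximal F|, r).
Proof.
move=> r_gt0 /vee2_free freeF; apply: (@num_copies_le _ _ _ _ (comparables F)).
move=> G sGF /wedge_copyP[t [S [cS ltS defG]]].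
have Ft : t \in F by rewrite (subsetP sGF) // defG setU11.
have FS A : A \in S -> A \in F.
  by move=> SA; rewrite (subsetP sGF) // defG setU1r.
exists S; rewrite ?cS ?eqxx ?andbT.
  apply/subsetP=> A SA; rewrite inE FS //=.
  by apply/exists_inP; exists t => //; apply: ltS.
apply/setP=> X; rewrite defG in_setU1 inE.
apply/predU1P/andP => [[->|SX]|[FX /exists_inP[A SA cmpXA]]].
(* Here [r > 0] matters: the top is recovered only through a member of [S] below it. *)
- have /card_gt0P[A SA] : 0 < #|S| by rewrite cS.
  split=> //; apply/exists_inP; exists A => //.
  by rewrite (proper_sub (ltS A SA)) orbT.
- by split; [exact: FS | apply/exists_inP; exists X; rewrite ?subxx].
have [-> | neXA] := eqVneq X A; first by right.
have ltAt := ltS A SA; have FA := FS A SA.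
case/orP: cmpXA => sub; last first.
  by left; apply: (freeF A) => //; rewrite properEneq eq_sym neXA.
have ltXA : X \proper A by rewrite properEneq neXA.
by have := ltAt; rewrite (freeF X A t) ?properxx // (proper_trans ltXA).
Qed.

(** In a chain [A], [B], [C] the least set has two proper supersets. *)
Lemma nonmaximal_antichain F :
    num_copies (vee 2) F = 0 ->
  {in nonmaximal F &, forall A B : {set T}, A \subset B -> A = B}.
Proof.
move=> /vee2_free freeF A B; rewrite !inE => /andP[FA _].
case/andP=> FB /exists_inP[C FC ltBC] sAB; apply/eqP/negPn/negP=> neAB.
have ltAB : A \proper B by rewrite properEneq neAB.
by have := ltBC; rewrite (freeF A B C) ?properxx // (proper_trans ltAB).
Qed.

Definition middles F :=
  [set A in F | [exists B in F, B \proper A] && [exists B in F, A \proper B]].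

(** For [A] in [S], a set [X] properly below [A] must equal [a], as [X] and [a] both lie below [A]
    and [c]. Dually, a set properly above [A] must equal [c]. *)
Lemma diamond_copies_le r F :
    0 < r -> num_copies butterfly F = 0 ->
  num_copies (diamond r) F <= 'C(#|middles F|, r).
Proof.
move=> r_gt0 /butterfly_free freeF; apply: (@num_copies_le _ _ _ _ (comparables F)).
move=> G sGF /diamond_copyP[a [c [S [cS ltac ltS defG]]]].
have Fa : a \in F by rewrite (subsetP sGF) // defG !inE eqxx.
have Fc : c \in F by rewrite (subsetP sGF) // defG !inE eqxx orbT.
have FS A : A \in S -> A \in F.
  by move=> SA; rewrite (subsetP sGF) // defG inE SA orbT.
exists S; rewrite ?cS ?eqxx ?andbT.
  apply/subsetP=> A SA; rewrite inE FS //=; have /andP[ltaA ltAc] := ltS A SA.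
  by apply/andP; split; apply/exists_inP; [exists a | exists c].
have /card_gt0P[A0 SA0] : 0 < #|S| by rewrite cS.
have /andP[lta0 lt0c] := ltS A0 SA0.
apply/setP=> X; rewrite defG !inE -orbA.
apply/or3P/andP => [[/eqP->|/eqP->|SX]|[FX /exists_inP[A SA cmpXA]]].
- by split=> //; apply/exists_inP; exists A0 => //; rewrite proper_sub.
- by split=> //; apply/exists_inP; exists A0; rewrite // orbC proper_sub.
- by split; [exact: FS | apply/exists_inP; exists X; rewrite ?subxx].
have [-> | neXA] := eqVneq X A; first by constructor 3.
have /andP[ltaA ltAc] := ltS A SA; have FA := FS A SA.
have neAc : A <> c by move=> E; rewrite E properxx in ltAc.
have neaA : a <> A by move=> E; rewrite E properxx in ltaA.
case/orP: cmpXA => sub.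
  have ltXA : X \proper A by rewrite properEneq neXA.
  have ltXc := proper_trans ltXA ltAc.
  by constructor 1; case: (freeF X a A c) => // ->.
have ltAX : A \proper X by rewrite properEneq eq_sym neXA.
have ltaX := proper_trans ltaA ltAX.
by constructor 2; case: (freeF a A X c) => // ->.
Qed.

(** A chain of four sets is a weak butterfly: the two smaller ones lie below the two larger ones. *)
Lemma middles_antichain F :
    num_copies butterfly F = 0 ->
  {in middles F &, forall A B : {set T}, A \subset B -> A = B}.
Proof.
move=> /butterfly_free freeF A B; rewrite !inE.
case/and3P=> FA /exists_inP[a Fa ltaA] _ /and3P[FB _ /exists_inP[c Fc ltBc]] sAB.
apply/eqP/negPn/negP=> neAB.
have ltAB : A \proper B by rewrite properEneq neAB.
have [E|E] := freeF a A B c Fa FA FB Fc (proper_trans ltaA ltAB) ltAB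
  (proper_trans ltaA (proper_trans ltAB ltBc)) (proper_trans ltAB ltBc).
  by rewrite E properxx in ltaA.
by rewrite E properxx in ltBc.
Qed.

(** Let [g A] be a point of [B :\: A] for some [B] in [F] above [A]. If [A] lies in [g A' |: A'], it
    lies in the superset [B'] of [A']; then either [A] and [A'] lie properly below [B'] and
    coincide, or [A = B'] and [A'] starts a chain of three sets. *)
Lemma vee_wedge_free_nonmaximal F :
    num_copies (vee 2) F = 0 -> num_copies (wedge 2) F = 0 ->
  #|nonmaximal F| <= 'C(#|T|.-1, #|T|.-1 %/ 2).
Proof.
move=> /vee2_free freeV /wedge2_free freeW.
pose escapes A x := [exists B in F, (A \proper B) && (x \in B :\: A)].
have [->|[A0 NA0]] := set_0Vmem (nonmaximal F); first by rewrite cards0.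
have upP A : A \in nonmaximal F -> exists x, escapes A x.
  rewrite inE => /andP[FA /exists_inP[B FB ltAB]].
  have /properP[_ [x Bx nAx]] := ltAB.
  by exists x; apply/exists_inP; exists B; rewrite // ltAB inE Bx nAx.
(* A default value for [g], available because some set is nonmaximal. *)
have [x0 _] := upP A0 NA0.
pose g A := odflt x0 [pick x | escapes A x].
have gP A : A \in nonmaximal F ->
    exists B, [/\ B \in F, A \proper B, g A \in B & g A \notin A].
  move=> /upP[x px]; rewrite /g; case: pickP => [y|/(_ x)]; last by rewrite px.
  by case/exists_inP=> B FB /andP[ltAB /setDP[? ?]]; exists B.
apply: (@separated_covers_bound _ _ g) => [A /gP[B []] //|A A' NA NA' sub].
have [B [FB ltAB _ _]] := gP A NA; have [B' [FB' ltAB' gB' _]] := gP A' NA'.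
have FA : A \in F by move: NA; rewrite inE => /andP[].
have FA' : A' \in F by move: NA'; rewrite inE => /andP[].
have sAB' : A \subset B'.
  by apply: subset_trans sub _; rewrite subUset sub1set gB' proper_sub.
have [E|neAB'] := eqVneq A B'; last first.
  by apply: (freeW A A' B') => //; rewrite properEneq neAB'.
have ltA'A : A' \proper A by rewrite E.
by have := ltAB; rewrite (freeV A' A B) ?properxx // (proper_trans ltA'A).
Qed.
End Copies.

(** * Layers and extremal families *)

Section Layers.
Variable n : nat.
Implicit Types (A B C X : {set 'I_n}) (F S : {set {set 'I_n}}).

Definition layer (k : nat) : {set {set 'I_n}} := [set A : {set 'I_n} | #|A| == k].

Lemma card_layer k : #|layer k| = 'C(n, k).
Proof. by rewrite /layer card_draws card_ord. Qed.

Lemma setT_notin_layer k : k < n -> setT \notin layer k.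
Proof. by move=> lt_kn; rewrite inE cardsT card_ord gtn_eqF. Qed.

Lemma layer_antichain (k : nat) A B :
  A \in layer k -> B \in layer k -> A \proper B -> False.
Proof. by rewrite !inE => /eqP<- /eqP cB /proper_card; rewrite cB ltnn. Qed.

Lemma proper_setT (k : nat) A : k < n -> A \in layer k -> A \proper setT.
Proof.
move=> lt_kn LA; rewrite properEneq subsetT andbT.
by apply: contraNneq (setT_notin_layer lt_kn) => <-.
Qed.

Lemma La_vee_wedge r :
  0 < n -> 0 < r -> La n (vee 2) (wedge r) = 'C('C(n, n %/ 2), r).
Proof.
move=> n_gt0 r_gt0; have lt_kn : n %/ 2 < n by lia.
apply: (@La_fam_eq _ _ _ _ (setT |: layer (n %/ 2))) => [||F /andP[/eqP freeF _]].
- rewrite /= andbT; apply/eqP/vee2_free.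
  have top A B : A \in setT |: layer (n %/ 2) -> B \in setT |: layer (n %/ 2) ->
      A \proper B -> B = setT.
    case/setU1P=> [->|LA]; first by rewrite properE subsetT andbC.
    by case/setU1P=> // LB /(layer_antichain LA LB).
  by move=> A B C FA FB FC /(top _ _ FA FB)-> /(top _ _ FA FC)->.
- rewrite -card_layer; apply: (@num_copies_ge _ _ _ _ _ (fun S => setT |: S)).
  move=> S sSL cS; split; first by rewrite setUS.
    apply/wedge_copyP; exists setT, S; split=> // A SA.
    by apply: proper_setT lt_kn _; apply: (subsetP sSL).
  rewrite setIUl (setIidPl sSL) (_ : _ :&: _ = set0) ?set0U //.
  by apply/setP=> A; rewrite in_setI in_set1 in_set0; apply: contraNF
    (setT_notin_layer lt_kn) => /andP[/eqP->].
- apply: leq_trans (wedge_copies_le r_gt0 freeF) _; apply: leq_bin2l.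
  by have := sperner (nonmaximal_antichain freeF); rewrite card_ord.
Qed.

Lemma La_butterfly_diamond r :
    0 < n -> 0 < r -> (n, r) <> (1, 1) ->
  La n butterfly (diamond r) = 'C('C(n, n %/ 2), r).
Proof.
move=> n_gt0 r_gt0 not11.
have upper F : all (fun P => num_copies P F == 0) [:: butterfly] ->
    num_copies (diamond r) F <= 'C('C(n, n %/ 2), r).
  case/andP=> /eqP freeF _; apply: leq_trans (diamond_copies_le r_gt0 freeF) _.
  apply: leq_bin2l.
  by have := sperner (middles_antichain freeF); rewrite card_ord.
(* For [n = 1] the middle layer consists of the empty set, so the general construction breaks down;
   but then [r > 1], the claimed value is 0, and the empty family will do. *)
have [n1 | n_neq1] := eqVneq n 1.
  apply: (@La_fam_eq _ _ _ _ set0) => //; last first.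
    by rewrite bin_small // n1 bin0; case: (r) r_gt0 not11 => [|[|]]; rewrite ?n1.
  rewrite /= andbT; apply/eqP/num_copies0 => G; rewrite subset0 => /eqP->.
  apply/is_copyP => -[phi [_ im_phi _]].
  by have := imset_f phi (in_setT (false, false)); rewrite im_phi inE.
have k_gt0 : 0 < n %/ 2 by lia.
have lt_kn : n %/ 2 < n by lia.
have nL0 : set0 \notin layer (n %/ 2) by rewrite inE cards0 ltn_eqF.
have lt0 A : A \in layer (n %/ 2) -> set0 \proper A.
  by move=> LA; rewrite proper0; apply: contraNneq nL0 => <-.
pose F0 := [set set0; setT] :|: layer (n %/ 2).
apply: (@La_fam_eq _ _ _ _ F0) => //.
- rewrite /= andbT; apply/eqP/butterfly_free.
  have F0P X : X \in F0 -> [\/ X = set0, X = setT | X \in layer (n %/ 2)].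
    by case/setUP=> [/set2P[]|]; [constructor 1 | constructor 2 | constructor 3].
  (* Below a member of the layer there is only the empty set, so two distinct sets have no common
     proper superset except the full set. *)
  have two_below A B C : A \in F0 -> B \in F0 -> C \in F0 ->
      A \proper C -> B \proper C -> A = B \/ C = setT.
    move=> FA FB /F0P[->|->|LC] ltAC ltBC; last first.
    + left; have below0 X : X \in F0 -> X \proper C -> X = set0.
        case/F0P=> [->|->|LX] //; first by rewrite properE subsetT andbC.
        by move/(layer_antichain LX LC).
      by rewrite (below0 A FA ltAC) (below0 B FB ltBC).
    + by right.
    + by move: ltAC; rewrite properE sub0set andbC.
  move=> A B C D FA FB FC FD ltAC ltBC ltAD ltBD.
  have [E|->] := two_below A B C FA FB FC ltAC ltBC; first by left.
  by have [E|->] := two_below A B D FA FB FD ltAD ltBD; [left | right].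
- rewrite -card_layer; apply: (@num_copies_ge _ _ _ _ _ (fun S => [set set0; setT] :|: S)).
  move=> S sSL cS; split; first by rewrite setUS.
    apply/diamond_copyP; exists set0, setT, S; split=> // [|A SA].
      by rewrite proper0 -card_gt0 cardsT card_ord.
    have LA := subsetP sSL A SA.
    by rewrite lt0 // (proper_setT lt_kn).
  rewrite setIUl (setIidPl sSL) (_ : _ :&: _ = set0) ?set0U //.
  apply/setP=> A; rewrite in_setI in_set2 in_set0.
  by apply/andP=> -[/orP[]/eqP->]; apply/negP; rewrite ?setT_notin_layer.
Qed.

End Layers.

(** The ground set has [n.+1] points: the extra point [z] may be added to or left out of any
    [k]-subset of the others, and this produces all comparable pairs of [F0]. *)
Lemma La_vee_wedge_chain2 n :
  La_fam n.+1 [:: vee 2; wedge 2] [:: chain 2] = 'C(n, n %/ 2).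
Proof.
rewrite La_fam_chain2; set k := n %/ 2; pose z : 'I_n.+1 := ord_max.
pose F0 := [set A : {set 'I_n.+1} | #|A :\ z| == k].
apply: (@La_fam_eq _ _ _ _ F0) => [||F /and3P[/eqP freeV /eqP freeW _]].
- have pairs (A B : {set 'I_n.+1}) : A \in F0 -> B \in F0 -> A \proper B ->
      A = B :\ z /\ B = z |: A.
    rewrite !inE => /eqP cA /eqP cB /properP[sAB [x Bx nAx]].
    (* Nested sets of equal size [k] coincide, so only [z] can distinguish [A] from [B]. *)
    have E : A :\ z = B :\ z.
      by apply/eqP; rewrite eqEcard setSD // cA cB leqnn.
    have xz : x = z.
      by apply/eqP; have /setP/(_ x) := E; rewrite !inE Bx (negbTE nAx) andbT andbF; case: eqP.
    have nAz : z \notin A by rewrite -xz.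
    have AE : A = B :\ z.
      by rewrite -E; apply/esym/setDidPl; rewrite disjoint_sym disjoints1.
    by split=> //; rewrite AE setD1K // -xz.
  apply/and3P; split=> //; apply/eqP; [apply/vee2_free | apply/wedge2_free].
    by move=> A B C FA FB FC /(pairs _ _ FA FB)[_ ->] /(pairs _ _ FA FC)[_ ->].
  by move=> A B C FA FB FC /(pairs _ _ FA FC)[-> _] /(pairs _ _ FB FC)[-> _].
(* The lower members of the pairs; each is completed by adding [z]. *)
- pose N := [set A : {set 'I_n.+1} | A \subset [set~ z] & #|A| == k].
  have -> : 'C(n, k) = 'C(#|N|, 1).
    by rewrite bin1 cards_draws cardsC1 card_ord.
  apply: (@num_copies_ge _ _ _ _ _ (fun S => S :|: [set z |: A | A in S])).
  move=> S sSN /eqP/cards1P[A SA]; rewrite SA imset_set1.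
  have := subsetP sSN A; rewrite SA !inE eqxx => /(_ isT)/andP[].
  rewrite subsetC sub1set inE => nAz /eqP cA.
  have AD : A :\ z = A by apply/setDidPl; rewrite disjoint_sym disjoints1.
  split.
  + by rewrite subUset !sub1set !inE setU1K // AD cA eqxx.
  + apply/wedge_copyP; exists (z |: A), [set A]; split; rewrite ?cards1 //.
      move=> _ /set1P->; rewrite properE subsetUr.
      by apply/subsetPn; exists z; rewrite ?setU11.
    by rewrite setUC.
  + apply/setP=> X; rewrite !inE; apply/andP/eqP => [[/orP[]/eqP->] //|->].
      by rewrite subsetC sub1set !inE eqxx.
    by rewrite eqxx subsetC sub1set inE nAz cA eqxx.
- apply: leq_trans (wedge_copies_le _ freeV) _ => //; rewrite bin1.
  by have := vee_wedge_free_nonmaximal freeV freeW; rewrite card_ord.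
Qed.

(** The diamond clause excludes [n = r = 1]: a one-point set has only two subsets, hence no copy of
    the three-element [diamond 1], while the binomial expression equals 1. *)
Theorem theorem1p3 (n r : nat) (n_gt0 : 0 < n) (r_gt0 : 0 < r) :
  [/\ La n (vee 2) (chain 2) = 'C(n, n %/ 2)
        /\ La n (wedge 2) (chain 2) = 'C(n, n %/ 2),
      La_fam n [:: vee 2; wedge 2] [:: chain 2] = 'C(n.-1, n.-1 %/ 2),
      (n, r) <> (1, 1) -> La n butterfly (diamond r) = 'C('C(n, n %/ 2), r)
    & La n (vee 2) (wedge r) = 'C('C(n, n %/ 2), r)
        /\ La n (wedge 2) (vee r) = 'C('C(n, n %/ 2), r)].
Proof.
have chain2_dual : dual_posets (chain 2) (chain 2).
  exists (@rev_ord 2) => [|x y]; first by apply: inj_card_bij => //; apply: rev_ord_inj.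
  by case: x y => [[|[|//]] ?] [[|[|//]] ?].
have dual r' := La_dual n (wedge_vee_dual 2) (dual_posets_sym (wedge_vee_dual r')).
split; first 1 last.
- by case: n n_gt0 {dual} => // n _; apply: La_vee_wedge_chain2.
- exact: La_butterfly_diamond.
- by rewrite dual La_vee_wedge.
(* The two-element chain is self-dual, so both equalities reduce to the pair ([vee 2],
   [wedge 1]). *)
rewrite (La_dual n (wedge_vee_dual 2) chain2_dual).
by rewrite /La La_fam_chain2 [La_fam _ _ _]La_vee_wedge // bin1.
Qed.
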